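(* Let $G$ be a connected roadmap with $n$ vertices, let $m<n$ be the number of robots, and let $\gamma$ be the ratio of the longest to the shortest edge length of $G$. Let $\mathrm{RT}^*$ be the minimum refresh time on $G$. Let $\tau$ be an open tour with $2n-4$ edges that visits all $n$ vertices, and let $\Gamma$ be the chain roadmap associated with $\tau$. Let $\mathrm{RT}^*_\Gamma$ be the minimum refresh time on $\Gamma$. Then $$\mathrm{RT}^*_\Gamma\le\Big(\frac{n-2}{n}\Big)\,8\gamma\,\mathrm{RT}^*.$$
   Context: A roadmap is a connected undirected graph whose vertices are viewpoints and whose edges are paths of positive length satisfying the triangle inequality; $m$ robots move on it with speed at most $1$. A team trajectory is $X=(x_1,\dots,x_m)$, $x_i:[0,T_f]\to G$ continuous and piecewise differentiable, with $T_f$ a fixed horizon much larger than the time a single robot needs to visit all viewpoints. $\mathrm{RT}(X)=\max_v\max_{(t_1,t_2)\in\Omega(v,X)}(t_2-t_1)$ with $\Omega(v,X)=\{(t_1,t_2)\in[0,T_f]^2:t_1\le t_2,\ x_i(t)\ne v\ \forall i,\ \forall t\in(t_1,t_2)\}$; the minimum refresh time on a roadmap is $\min_X\mathrm{RT}(X)$. An open tour is a walk (sequence of vertices, consecutive ones adjacent) in $G$, not necessarily closed, containing every vertex. The chain roadmap $\Gamma$ associated with $\tau=(u_0,u_1,\dots,u_L)$ has vertices $0,1,\dots,L$ (repeated vertices of $\tau$ being duplicated as distinct vertices) and edges $\{k-1,k\}$ whose length equals the length of the edge $\{u_{k-1},u_k\}$ of $G$. *)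

(* Defs.v *)
From HB Require Import structures.
From mathcomp Require Import all_boot all_order all_algebra.
From mathcomp Require Import zify.
From mathcomp Require Import all_classical all_reals all_analysis.
Set Implicit Arguments.
Unset Strict Implicit.
Unset Printing Implicit Defensive.
Import Order.TTheory GRing.Theory Num.Theory.
Import numFieldNormedType.Exports.
Local Open Scope classical_set_scope.
Local Open Scope ring_scope.

(* [len u v] is meaningful only when [adj u v]. *)
Record roadmap (R : realType) := Roadmap {
  vertex :> finType;
  adj : rel vertex;
  len : vertex -> vertex -> R;
  adj_sym : symmetric adj;
  adj_irr : irreflexive adj;
  adj_connected : forall u v, connect adj u v;
  len_sym : forall u v, len u v = len v u;
  len_gt0 : forall u v, adj u v -> 0 < len u v;
  len_triangle : forall u v w, adj u v -> adj v w -> adj u w ->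
    len u w <= len u v + len v w
}.

Section Roadmap.
Variables (R : realType) (G : roadmap R).

Definition longest_edge : R :=
  \big[Num.max/0]_(e : G * G | adj e.1 e.2) len e.1 e.2.

Definition shortest_edge : R :=
  \big[Num.min/longest_edge]_(e : G * G | adj e.1 e.2) len e.1 e.2.

Definition edge_ratio : R := longest_edge / shortest_edge.

(* Points of the metric graph G are given by their barycentric coordinates:
   the point at distance [s * len u v] from [u] on the edge {u, v} has
   coordinates [1 - s] at [u], [s] at [v], and 0 elsewhere. *)
Definition vertex_pt (v : G) : G -> R := fun w => (w == v)%:R.

Definition edge_pt (u v : G) (s : R) : G -> R :=
  fun w => (1 - s) * vertex_pt u w + s * vertex_pt v w.

Definition points : set (G -> R) :=
  [set p | (exists v, p = vertex_pt v) \/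
           (exists u v s, [/\ adj u v, 0 <= s <= 1 & p = edge_pt u v s])].

(* Inside the edge {u, v} the arc length from [v] is [len u v * x t u], hence
   the speed in [trajectory_speed]. Where x is differentiable and located at a
   vertex, its derivative vanishes since coordinates are in [0, 1]. *)
Record trajectory (T : R) (x : R -> G -> R) : Prop := Trajectory {
  trajectory_points : forall t, 0 <= t <= T -> points (x t);
  trajectory_continuous : forall v, {within `[0, T], continuous (x^~ v)};
  trajectory_pw_derivable : exists s : seq R, forall t, 0 < t < T ->
    t \notin s -> forall v, derivable (x^~ v) t 1;
  trajectory_speed : forall t u v, 0 < t < T -> adj u v ->
    0 < x t u -> 0 < x t v -> derivable (x^~ u) t 1 ->
    len u v * `|derive1 (x^~ u) t| <= 1
}.

Definition single_robot_visits_all (T : R) : Prop :=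
  exists2 x, trajectory T x &
    forall v, exists2 t, 0 <= t <= T & x t = vertex_pt v.

Section Team.
Variables (m : nat) (Tf : R).

Definition team := 'I_m -> R -> G -> R.

Definition team_trajectory (X : team) : Prop := forall i, trajectory Tf (X i).

Definition Omega (v : G) (X : team) : set (R * R) :=
  [set t | [/\ 0 <= t.1 <= Tf, 0 <= t.2 <= Tf, t.1 <= t.2 &
              forall i s, t.1 < s < t.2 -> X i s <> vertex_pt v]].

(* The supremum is a maximum: see [refresh_gap_max]. *)
Definition refresh_time (X : team) : R :=
  \big[Num.max/0]_(v : G) sup [set t.2 - t.1 | t in Omega v X].

(* Stated as an infimum, so as not to presuppose that the minimum is attained;
   it is the minimum whenever there is one: see [min_refresh_timeE]. *)
Definition min_refresh_time : R :=
  inf [set refresh_time X | X in team_trajectory].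

Lemma Omega_closed v X : closed (Omega v X).
Proof.
have c1 : continuous (fun t : R * R => t.1) by move=> t; exact: cvg_fst.
have c2 : continuous (fun t : R * R => t.2) by move=> t; exact: cvg_snd.
have cle (a b : R * R -> R) : continuous a -> continuous b ->
    closed [set t | a t <= b t].
  move=> ca cb; rewrite (_ : mkset _ = (b \- a) @^-1` [set y | 0 <= y]).
    apply: preimage_closed; last exact: closed_ge.
    by move=> t _; apply: cvgB; [exact: cb | exact: ca].
  by apply/seteqP; split=> t /=; rewrite subr_ge0.
have ccst (c : R) : continuous (fun _ : R * R => c) by move=> t; exact: cvg_cst.
rewrite (_ : Omega v X =
    [set t | 0 <= t.1] `&` [set t | t.1 <= Tf] `&`
    ([set t | 0 <= t.2] `&` [set t | t.2 <= Tf]) `&` [set t | t.1 <= t.2] `&`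
    \bigcap_(s in [set s | exists i, X i s = vertex_pt v])
      ([set t | s <= t.1] `|` [set t | t.2 <= s])).
  do 4?apply: closedI; do ?exact: cle.
  by apply: closed_bigI => s _; apply: closedU; exact: cle.
apply/seteqP; split=> t.
  move=> [/andP[? ?] /andP[? ?] ? h]; do !split=> //.
  move=> s [i Xis] /=; case: (leP s t.1) => [|ts]; first by left.
  by case: (leP t.2 s) => [|st]; [right | case: (h i s); rewrite ?ts].
move=> [[[[? ?] [? ?]] ?] h]; split=> //; try by apply/andP.
move=> i s /andP[ts st] Xis; case: (h s) => /=; first by exists i.
  by rewrite leNgt ts.
by rewrite leNgt st.
Qed.

Lemma refresh_gap_max v X : 0 <= Tf ->
  exists2 t, Omega v X t & sup [set t.2 - t.1 | t in Omega v X] = t.2 - t.1.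
Proof.
move=> Tf0.
have nO : Omega v X !=set0.
  exists (0, 0); split; rewrite /= ?lexx //.
  by move=> i s /andP[/lt_trans/[apply]]; rewrite ltxx.
have cO : compact (Omega v X).
  apply: (@subclosed_compact _ _ (`[0, Tf] `*` `[0, Tf])).
  - exact: Omega_closed.
  - by apply: compact_setX; exact: segment_compact.
  - by move=> t [h1 h2 _ _]; split; rewrite /= in_itv.
have cf : {within Omega v X, continuous (fun t : R * R => t.2 - t.1)}.
  apply: continuous_subspaceT => t.
  by apply: cvgB; [exact: cvg_snd | exact: cvg_fst].
have [t /set_mem Ot tmax] := compact_EVT_max nO cO cf.
exists t => //; apply/le_anti/andP; split.
  apply: ge_sup; first exact: image_nonempty.
  by move=> _ [s Os <-]; apply: tmax; exact: mem_set.
apply: ub_le_sup; last by exists t.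
by exists (t.2 - t.1) => _ [s Os <-]; apply: tmax; exact: mem_set.
Qed.

Lemma min_refresh_timeE X : team_trajectory X ->
  (forall Y, team_trajectory Y -> refresh_time X <= refresh_time Y) ->
  min_refresh_time = refresh_time X.
Proof.
move=> hX Xmin; apply/le_anti/andP; split.
  apply: ge_inf; last by exists X.
  by exists (refresh_time X) => _ [Y hY <-]; exact: Xmin.
apply: lb_le_inf; first by exists (refresh_time X), X.
by move=> _ [Y hY <-]; exact: Xmin.
Qed.

End Team.

Record open_tour := OpenTour {
  tour_start : G;
  tour_tail : seq G;
  tour_path : path (@adj R G) tour_start tour_tail;
  tour_covers : forall v, v \in tour_start :: tour_tail
}.

Definition tour_edges (tau : open_tour) : nat := size (tour_tail tau).

Definition tour_vertex (tau : open_tour) (k : nat) : G :=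
  nth (tour_start tau) (tour_start tau :: tour_tail tau) k.

Section Chain.
Variable tau : open_tour.

Let V := 'I_(tour_edges tau).+1.

Definition chain_adj : rel V :=
  fun i j => (i.+1 == j :> nat) || (j.+1 == i :> nat).

Definition chain_len (i j : V) : R :=
  len (tour_vertex tau i) (tour_vertex tau j).

Lemma chain_adj_sym : symmetric chain_adj.
Proof. by move=> i j; rewrite /chain_adj orbC. Qed.

Lemma chain_adj_irr : irreflexive chain_adj.
Proof. by move=> i; rewrite /chain_adj orbb eqn_leq ltnn. Qed.

Lemma chain_adj_connected (i j : V) : connect chain_adj i j.
Proof.
have from0 k (hk : (k < (tour_edges tau).+1)%N) :
    connect chain_adj ord0 (Ordinal hk).
  elim: k hk => [hk|k IH hk].
    by rewrite (_ : Ordinal hk = ord0); [exact: connect0 | exact: val_inj].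
  apply: connect_trans (IH (ltnW hk)) (connect1 _).
  by rewrite /chain_adj /= eqxx.
have from0' (k : V) : connect chain_adj ord0 k.
  by case: k => k hk; exact: from0.
apply: (@connect_trans _ _ ord0); last exact: from0'.
by rewrite (sym_connect_sym chain_adj_sym).
Qed.

Lemma chain_len_sym (i j : V) : chain_len i j = chain_len j i.
Proof. exact: len_sym. Qed.

Lemma chain_len_gt0 (i j : V) : chain_adj i j -> 0 < chain_len i j.
Proof.
have step (k l : V) : k.+1 = l :> nat -> 0 < chain_len k l.
  move=> kl; apply: len_gt0; rewrite /tour_vertex -kl /=.
  have := tour_path tau => /(pathP (tour_start tau)); apply.
  by rewrite -ltnS kl.
by case/orP=> /eqP /step //; rewrite chain_len_sym.
Qed.

Lemma chain_len_triangle (i j k : V) : chain_adj i j -> chain_adj j k ->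
  chain_adj i k -> chain_len i k <= chain_len i j + chain_len j k.
Proof. by move=> /orP[]/eqP ij /orP[]/eqP jk /orP[]/eqP ik; exfalso; lia. Qed.

Definition chain_roadmap : roadmap R :=
  Roadmap chain_adj_sym chain_adj_irr chain_adj_connected chain_len_sym
    chain_len_gt0 chain_len_triangle.

End Chain.
End Roadmap.

(* Main.v *)
Require Import Defs.
From HB Require Import structures.
From mathcomp Require Import all_boot all_order all_algebra.
From mathcomp Require Import zify ring lra.
From mathcomp Require Import all_classical all_reals all_analysis.
Set Implicit Arguments.
Unset Strict Implicit.
Unset Printing Implicit Defensive.
Import Order.TTheory GRing.Theory Num.Theory.
Import numFieldNormedType.Exports.
Local Open Scope classical_set_scope.
Local Open Scope ring_scope.

(** Lower bound: every coordinate of a trajectory changes at rate at most the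
    inverse of the shortest edge length [l], so a robot needs time [l] between
    visits to two distinct vertices. If all [n] vertices are visited within
    time [r], sending a vertex to the robot visiting it and to [floor (t / l)],
    [t] the time of the visit, is injective; thus [n <= m (floor (r / l) + 1)],
    and [m < n] makes the floor positive, whence [n l <= 2 m r].

    Upper bound: on the chain with [L = 2n - 4] edges, each robot sweeps back
    and forth over [L / m] (rounded down) consecutive edges, spending on each
    edge the length [h] of the longest edge of [G]. These sweeps cover all
    vertices and give refresh time at most [2 (L / m) h]. *)

(** * Increment bounds, Lipschitz functions and ramps on the real line *)

Section RealFunctions.
Variable R : realType.
Implicit Types (f : R -> R) (a b h t : R).

(** Mean value theorem, after splitting the interval at the exceptional points by induction on [s].
    A bound on the derivative is required only where [0 < f t < 1]: where [f t] is 0 or 1, [t] is an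
    interior extremum and the derivative vanishes. *)
Lemma unit_valued_increment_le (s : seq R) f (K a b : R) : 0 <= K -> a <= b ->
  {within `[a, b], continuous f} ->
  (forall t, a < t < b -> t \notin s -> derivable f t 1) ->
  (forall t, a < t < b -> 0 <= f t <= 1) ->
  (forall t, a < t < b -> derivable f t 1 -> 0 < f t < 1 ->
    `|derive1 f t| <= K) ->
  `|f b - f a| <= K * (b - a).
Proof.
move=> K0; elim: s a b => [|c s IH] a b ab fc fd f01 fK.
  have fd' t : t \in `]a, b[ -> derivable f t 1.
    by rewrite in_itv /= => tab; exact: fd.
  have f01' t : t \in `]a, b[ -> 0 <= f t <= 1.
    by rewrite in_itv /= => tab; exact: f01.
  move: (ab); rewrite le_eqVlt => /predU1P[->|altb].
    by rewrite !subrr normr0 mulr0.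
  have [||t tab ->] := @MVT R f (derive1 f) a b altb.
  - by move=> t /fd' dt; rewrite derive1E; exact: derivableP.
  - exact: fc.
  rewrite normrM [`|b - a|]ger0_norm ?subr_ge0 //.
  apply: ler_wpM2r; first by rewrite subr_ge0.
  have /andP[ft0 ft1] := f01' _ tab.
  have [ft|] := boolP (0 < f t < 1).
    by apply: fK => //; exact: fd'.
  rewrite negb_and -!leNgt => /orP[ft|ft].
    have /@derive_val : is_derive t 1 f 0.
      apply: (derive1_at_min ab fd' tab) => r /f01'/andP[r0 _].
      exact: le_trans ft r0.
    by rewrite derive1E => ->; rewrite normr0.
  have /@derive_val : is_derive t 1 f 0.
    apply: (derive1_at_max ab fd' tab) => r /f01'/andP[_ r1].
    exact: le_trans r1 ft.
  by rewrite derive1E => ->; rewrite normr0.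
have [/andP[ac cb]|cab] := boolP (a < c < b); last first.
  apply: IH => // t tab ts; apply: fd => //; rewrite inE negb_or ts andbT.
  by apply: contraNneq cab => <-.
have sub1 t : a < t < c -> a < t < b.
  by move=> /andP[-> /lt_trans]; exact.
have sub2 t : c < t < b -> a < t < b.
  by move=> /andP[/(lt_trans ac)-> ->].
have H1 : `|f c - f a| <= K * (c - a).
  apply: IH => [||t tac ts|t tac|t tac]; try exact: ltW.
  - apply: continuous_subspaceW fc => t /=; rewrite !in_itv /=.
    by move=> /andP[-> /le_trans]; apply; exact: ltW.
  - apply: fd; first exact: sub1.
    by rewrite inE negb_or ts andbT lt_eqF //; case/andP: tac.
  - exact/f01/sub1.
  - exact/fK/sub1.
have H2 : `|f b - f c| <= K * (b - c).
  apply: IH => [||t tac ts|t tac|t tac]; try exact: ltW.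
  - apply: continuous_subspaceW fc => t /=; rewrite !in_itv /=.
    by move=> /andP[/(le_trans (ltW ac))-> ->].
  - apply: fd; first exact: sub2.
    by rewrite inE negb_or ts andbT gt_eqF //; case/andP: tac.
  - exact/f01/sub2.
  - exact/fK/sub2.
rewrite (_ : f b - f a = (f b - f c) + (f c - f a)); last by rewrite subrKA.
apply: le_trans (ler_normD _ _) _; apply: le_trans (lerD H2 H1) _.
by rewrite -mulrDr subrKA.
Qed.

Lemma lipschitz_derive1_le f (K t : R) :
  (forall a b, `|f b - f a| <= K * `|b - a|) -> derivable f t 1 ->
  `|derive1 f t| <= K.
Proof.
move=> fK fd; rewrite derive1E.
have bnd : \forall h \near (0 : R)^',
    `|h^-1 *: ((f \o shift t) h%:A - f t)| <= K.
  near=> h.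
  have h0 : h != 0 by near: h; exact: nbhs_dnbhs_neq.
  rewrite normrZ normfV mulrC ler_pdivrMr ?normr_gt0 //=.
  by apply: le_trans (fK _ _) _; rewrite addrK /= [h%:A]mulr1.
rewrite ler_norml; apply/andP; split.
  by apply: limr_ge => //; apply: filterS bnd => h; rewrite ler_norml => /andP[].
by apply: limr_le => //; apply: filterS bnd => h; rewrite ler_norml => /andP[].
Unshelve. all: by end_near. Qed.

Lemma lipschitz_continuous f (K : R) :
  (forall a b, `|f b - f a| <= K * `|b - a|) -> continuous f.
Proof.
move=> fK t.
have K0 : 0 <= K by have := fK 0 1; rewrite subr0 normr1 mulr1; exact: le_trans.
(* [K] may be 0, so [K + 1] serves as the divisor of [e]. *)
have K1 : 0 < K + 1 by rewrite ltr_wpDl.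
apply/cvgrPdist_lt => e e0; near=> r.
apply: le_lt_trans (fK _ _) _.
apply: (@le_lt_trans _ _ ((K + 1) * `|t - r|)).
  by rewrite ler_wpM2r // lerDl.
rewrite mulrC -ltr_pdivlMr //; near: r.
by apply: cvgr_dist_lt; [exact: cvg_id | rewrite divr_gt0].
Unshelve. all: by end_near. Qed.

(** For [0 < h], climbs linearly from 0 to 1 during [[a, a + h]] and is constant elsewhere; one ramp
    will drive the passage along one edge. *)
Definition ramp a h t : R := Num.max 0 (Num.min 1 ((t - a) / h)).

Lemma ramp_le0 a h t : 0 < h -> t <= a -> ramp a h t = 0.
Proof.
move=> h0 ta; apply/max_idPl; rewrite ge_min; apply/orP; right.
by rewrite pmulr_lle0 ?invr_gt0 // subr_le0.
Qed.

Lemma ramp_ge1 a h t : 0 < h -> a + h <= t -> ramp a h t = 1.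
Proof.
move=> h0 ta; rewrite /ramp (min_idPl _); first by apply/max_idPr.
by rewrite ler_pdivlMr // mul1r lerBrDl.
Qed.

Lemma ramp_mid a h t : 0 < h -> a <= t <= a + h -> ramp a h t = (t - a) / h.
Proof.
move=> h0 /andP[at0 ta]; rewrite /ramp (min_idPr _).
  by apply/max_idPr; rewrite divr_ge0 ?subr_ge0 // ltW.
by rewrite ler_pdivrMr // mul1r lerBlDl.
Qed.

Lemma ramp_derivable a h t : 0 < h -> t != a -> t != a + h ->
  derivable (ramp a h) t 1.
Proof.
move=> h0 ta tah; have [tlta|altt|/eqP] := ltgtP t a; last by rewrite (negPf ta).
  apply: (@near_eq_derivable _ _ _ (cst 0)); last exact: derivable_cst.
  by near=> r; rewrite ramp_le0 // ltW //; near: r; exact: lt_nbhsl.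
have [tltb|bltt|/eqP] := ltgtP t (a + h); last by rewrite (negPf tah).
  apply: (@near_eq_derivable _ _ _ ((id - cst a) * cst h^-1)).
    near=> r; rewrite ramp_mid //; apply/andP; split; apply: ltW; near: r.
      exact: lt_nbhsr.
    exact: lt_nbhsl.
  apply: derivableM; last exact: derivable_cst.
  by apply: derivableB; [exact: derivable_id | exact: derivable_cst].
apply: (@near_eq_derivable _ _ _ (cst (1 : R))); last exact: derivable_cst.
by near=> r; rewrite ramp_ge1 // ltW //; near: r; exact: lt_nbhsr.
Unshelve. all: by end_near. Qed.

End RealFunctions.

(** * Lower bound on the refresh time of [G] *)

Section LowerBound.
Variables (R : realType) (G : roadmap R).

Lemma len_le_longest (u v : G) : adj u v -> len u v <= longest_edge G.
Proof.
move=> uv; exact: (@le_bigmax_cond _ _ _ 0 (u, v)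
  (fun e : G * G => adj e.1 e.2) (fun e => len e.1 e.2)).
Qed.

Lemma shortest_le_len (u v : G) : adj u v -> shortest_edge G <= len u v.
Proof.
move=> uv.
exact: (@bigmin_le_cond _ _ _ (longest_edge G) (u, v)
  (fun e : G * G => adj e.1 e.2) (fun e => len e.1 e.2)).
Qed.

Lemma exists_edge : (1 < #|G|)%N -> exists u v : G, adj u v.
Proof.
move=> /card_gt1P[u [v [_ _ uv]]].
have /connectP[[|w p] /= pp lp] := adj_connected u v.
  by rewrite lp eqxx in uv.
by exists u, w; case/andP: pp.
Qed.

Lemma longest_gt0 : (1 < #|G|)%N -> 0 < longest_edge G.
Proof.
move=> /exists_edge[u [v uv]].
exact: lt_le_trans (len_gt0 uv) (len_le_longest uv).
Qed.

Lemma shortest_gt0 : (1 < #|G|)%N -> 0 < shortest_edge G.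
Proof.
by move=> /longest_gt0 l0; apply: lt_bigmin => // e /len_gt0.
Qed.

Lemma vertex_pt_inj : injective (@vertex_pt R G).
Proof.
move=> u v /(congr1 (fun p : G -> R => p u)); rewrite /vertex_pt eqxx.
by case: eqP => // _ /eqP; rewrite oner_eq0.
Qed.

Lemma points_itv (p : G -> R) u : points p -> 0 <= p u <= 1.
Proof.
have v01 (v : G) : 0 <= (vertex_pt v u : R) <= 1.
  by rewrite /vertex_pt ler0n lern1 leq_b1.
case=> [[v ->] //|[v [w [s [_ /andP[s0 s1] ->]]]]]; rewrite /edge_pt.
by have := v01 v; have := v01 w; rewrite /vertex_pt; do 2!case: eqP => _ /=; lra.
Qed.

(** Such a point is interior to an edge ending at [u]; the other end supplies the second positive
    coordinate that [trajectory_speed] requires. *)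
Lemma points_inside (p : G -> R) u : points p -> 0 < p u < 1 ->
  exists2 v, adj u v & 0 < p v.
Proof.
case=> [[v ->]|[v [w [s [vw /andP[s0 s1] ->]]]]].
  by rewrite /vertex_pt; case: eqP; rewrite ltxx ?andbF.
have vNw : v != w by apply: contraTneq vw => ->; rewrite adj_irr.
rewrite /edge_pt /vertex_pt => pu.
have [uv|uNv] := eqVneq u v.
  move: pu; rewrite -{}uv in vw vNw *; rewrite eqxx (negPf vNw) /= => pu.
  by exists w => //; rewrite eqxx eq_sym (negPf vNw) /=; lra.
move: pu; rewrite (negPf uNv) /=; have [-> /= pu|_ /= pu] := eqVneq u w; last by lra.
by exists v; [rewrite adj_sym | rewrite eqxx (negPf vNw) /=; lra].
Qed.

(** The coordinate at [u] falls from 1 to 0 between the two visits. Strictly between these values,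
    the speed limit bounds its rate by the inverse of the length of the current edge, hence by that
    of the shortest one. *)
Lemma visits_apart (T : R) (x : R -> G -> R) (a b : R) (u v : G) :
  (1 < #|G|)%N -> trajectory T x -> 0 <= a -> b <= T -> a <= b -> u != v ->
  x a = vertex_pt u -> x b = vertex_pt v -> shortest_edge G <= b - a.
Proof.
move=> n1 xT a0 bT ab uv xa xb; have l0 := shortest_gt0 n1.
have inT t : a < t < b -> 0 < t < T.
  by move=> /andP[/(le_lt_trans a0)-> /lt_le_trans]; exact.
have inT' t : a < t < b -> 0 <= t <= T.
  by move=> /inT/andP[/ltW-> /ltW].
have [s xs] := trajectory_pw_derivable xT.
have : `|x b u - x a u| <= (shortest_edge G)^-1 * (b - a).
  apply: (@unit_valued_increment_le _ s (x^~ u)) => //.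
  - by rewrite invr_ge0 ltW.
  - apply: continuous_subspaceW (@trajectory_continuous _ _ _ _ xT u) => t /=.
    by rewrite !in_itv /= => /andP[/(le_trans a0)-> /le_trans]; exact.
  - by move=> t tab ts; apply: xs => //; exact: inT.
  - by move=> t /inT' tT; exact/points_itv/(trajectory_points xT).
  move=> t tab dt xt.
  have [w uw xw] := points_inside (trajectory_points xT (inT' _ tab)) xt.
  have := trajectory_speed xT (inT _ tab) uw (proj1 (andP xt)) xw dt.
  move=> speed; rewrite -[leRHS]mulr1 ler_pdivlMl //.
  by apply: le_trans speed; rewrite ler_wpM2r // shortest_le_len.
rewrite xa xb /vertex_pt eqxx (negPf uv) sub0r normrN normr1.
by rewrite mulrC ler_pdivlMr // mul1r.
Qed.

Lemma covering_time_ge (m : nat) (T r : R) (X : team G m) :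
  (1 < #|G|)%N -> (m < #|G|)%N -> team_trajectory T X -> 0 <= r <= T ->
  (forall v, exists i t, 0 <= t <= r /\ X i t = vertex_pt v) ->
  #|G|%:R * shortest_edge G <= 2 * m%:R * r.
Proof.
move=> n1 mn XT /andP[r0 rT] cov; have l0 := shortest_gt0 n1.
set l := shortest_edge G in l0 *.
have [f fP] := choice cov; have [g gP] := choice fP.
have tk v : (Num.truncn (g v / l) < (Num.truncn (r / l)).+1)%N.
  rewrite ltnS le_truncn // ler_pM2r ?invr_gt0 //.
  by case: (gP v) => /andP[].
have apart u v : f u = f v -> g u <= g v -> u != v -> l <= g v - g u.
  move=> fuv guv uNv; have [/andP[gu0 gur] xu] := gP u.
  have [/andP[gv0 gvr] xv] := gP v; rewrite -fuv in xv.
  exact: (visits_apart n1 (XT _) gu0 (le_trans gvr rT) guv uNv xu xv).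
have bucket u v : Num.truncn (g u / l) = Num.truncn (g v / l) -> g v - g u < l.
  move=> tuv.
  have ge0 z : 0 <= g z / l.
    by rewrite divr_ge0 ?(ltW l0) //; case: (gP z) => /andP[].
  have := truncn_itv (ge0 u); have := truncn_itv (ge0 v).
  rewrite tuv => /andP[_ h1] /andP[h2 _].
  rewrite -[ltRHS]mul1r -ltr_pdivrMr // mulrBl; rewrite -natr1 in h1; lra.
(* Two vertices with the same robot and the same time slot would be visited less than [l] apart by
   that robot. *)
have inj : injective (fun v => (f v, Ordinal (tk v))).
  move=> u v [fuv tuv]; apply/eqP; apply: contraT => uNv.
  case: (leP (g u) (g v)) => guv.
    by have := apart _ _ fuv guv uNv; rewrite leNgt bucket.
  have := apart _ _ (esym fuv) (ltW guv); rewrite eq_sym => /(_ uNv).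
  by rewrite leNgt bucket.
have := leq_card _ inj; rewrite card_prod !card_ord => ncard.
(* A zero floor would give [#|G| <= m]. A floor [k >= 1] satisfies [k + 1 <= 2 * k], which is where
   the factor 2 comes from. *)
have k1 : (0 < Num.truncn (r / l))%N by move: ncard mn; case: Num.truncn => //; lia.
have : (#|G| <= 2 * m * Num.truncn (r / l))%N by nia.
rewrite -(ler_nat R) !natrM => h.
rewrite -ler_pdivlMr // -[leRHS]mulrA; apply: le_trans h _.
by rewrite ler_wpM2l // truncn_le divr_ge0 // ltW.
Qed.

Lemma refresh_time_ge (m : nat) (T1 Tf : R) (X : team G m) :
  (1 < #|G|)%N -> (0 < m < #|G|)%N ->
  single_robot_visits_all G T1 -> T1 < Tf -> team_trajectory Tf X ->
  #|G|%:R * shortest_edge G <= 2 * m%:R * refresh_time Tf X.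
Proof.
move=> n1 /andP[m0 mn] [x xT xv] T1f XT.
have m0' : 0 < 2 * m%:R :> R by rewrite mulr_gt0 // ltr0n.
have T10 : 0 <= T1.
  have /card_gt0P[v _] := ltnW n1.
  by have [t /andP[t0 tT] _] := xv v; exact: le_trans t0 tT.
have Tf0 : 0 <= Tf by exact: le_trans T10 (ltW T1f).
(* If the refresh time reaches the horizon, it exceeds [T1], and the covering bound for the single
   robot over [[0, T1]] suffices. *)
have [rT|Tr] := leP Tf (refresh_time Tf X).
  have := @covering_time_ge 1 T1 T1 (fun=> x) n1 n1 (fun=> xT).
  rewrite T10 lexx => /(_ isT) H; apply: le_trans (H _) _.
    by move=> v; have [t tT xt] := xv v; exists ord0, t.
  apply: (@le_trans _ _ (2 * m%:R * T1)).
    by rewrite ler_wpM2r // ler_wpM2l // ler_nat.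
  by rewrite ler_pM2l //; exact: le_trans (ltW T1f) rT.
(* A vertex unvisited during [[0, r]] makes [(0, r)] a gap longer than the refresh time; this is why
   [r] is taken strictly above it. *)
have key r : refresh_time Tf X < r <= Tf ->
    #|G|%:R * shortest_edge G <= 2 * m%:R * r.
  move=> /andP[rr rT].
  have r0 : 0 <= r.
    by apply: le_trans (ltW rr); exact: bigmax_ge_id.
  apply: (@covering_time_ge m Tf r X n1 mn XT); first by rewrite r0.
  move=> v; apply: contrapT => nv.
  have Or : Omega Tf v X (0, r).
    split; rewrite /= ?lexx ?Tf0 ?r0 // => i s /andP[s0 sr] xs.
    by apply: nv; exists i, s; rewrite !ltW.
  have := le_bigmax_cond 0
    (fun v => sup [set t.2 - t.1 | t in Omega Tf v X]) (isT : xpredT v).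
  apply/negP; rewrite -ltNge; apply: lt_le_trans rr _.
  apply: ub_le_sup; last by exists (0, r) => //=; rewrite subr0.
  exists Tf => _ [[t1 t2] [/= /andP[t10 _] /andP[_ t2T] _ _] <-]; lra.
rewrite leNgt; apply/negP => lt.
set c := #|G|%:R * shortest_edge G in key lt.
set r := refresh_time Tf X in key lt Tr.
have rc : r < c / (2 * m%:R) by rewrite ltr_pdivlMr // mulrC.
(* A midpoint capped by the horizon: above the refresh time, so that [key] applies, yet below
   [c / (2 * m)], which [key] contradicts. *)
pose r' := Num.min Tf ((r + c / (2 * m%:R)) / 2).
have : c <= 2 * m%:R * r'.
  by apply: key; rewrite ge_min lexx lt_min Tr /=; lra.
rewrite mulrC -ler_pdivrMr // leNgt => /negP; apply.
by rewrite gt_min; apply/orP; right; lra.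
Qed.

Lemma min_refresh_time_ge (m : nat) (T1 Tf : R) :
  (1 < #|G|)%N -> (0 < m < #|G|)%N ->
  single_robot_visits_all G T1 -> T1 < Tf ->
  #|G|%:R * shortest_edge G <= 2 * m%:R * min_refresh_time G m Tf.
Proof.
move=> n1 mn T1v T1f; have m0' : 0 < 2 * m%:R :> R.
  by rewrite mulr_gt0 // ltr0n; case/andP: mn.
rewrite -ler_pdivrMl //; apply: lb_le_inf.
  have /card_gt0P[v _] := ltnW n1.
  (* Robots parked at one vertex show that the infimum is over a nonempty set. *)
  exists (refresh_time Tf (fun (_ : 'I_m) _ => vertex_pt v)).
  exists (fun (_ : 'I_m) _ => vertex_pt v) => // i; split.
  - by move=> t _; left; exists v.
  - by move=> u; apply: continuous_subspaceT => t; exact: cvg_cst.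
  - by exists [::] => t _ _ u; exact: derivable_cst.
  - by move=> t u w _ _ _ _ _; rewrite derive1_cst normr0 mulr0.
move=> _ [X XT <-]; rewrite ler_pdivrMl //.
exact: (refresh_time_ge n1 mn T1v T1f XT).
Qed.

End LowerBound.

(** * Piecewise linear interpolation *)

Section Interpolation.
Variable R : realType.
Implicit Types (al : nat -> R) (h t : R) (N k : nat).

(** For [0 < h], the piecewise linear function with value [al j] at time [j * h] for [j <= N],
    constant outside [[0, N * h]]. Written as a sum of ramps, it inherits its regularity
    termwise. *)
Definition interp al h N t : R :=
  al 0%N + \sum_(j < N) (al j.+1 - al j) * ramp (j%:R * h) h t.

(** The ramps before the [k]-th have reached 1 and telescope to [al k - al 0]; those after it are
    still 0. *)
Lemma interp_segment al h N k t : 0 < h -> (k < N)%N ->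
  k%:R * h <= t <= k.+1%:R * h ->
  interp al h N t =
    (1 - (t - k%:R * h) / h) * al k + (t - k%:R * h) / h * al k.+1.
Proof.
move=> h0 kN /andP[kt tk].
rewrite /interp.
rewrite -(big_mkord xpredT (fun j => (al j.+1 - al j) * ramp (j%:R * h) h t)).
rewrite (@big_cat_nat _ _ _ k) //=; last exact: ltnW.
rewrite [X in _ + (_ + X)]big_ltn //.
rewrite [X in _ + (_ + (_ + X))]big1_seq; last first.
  move=> j /andP[_]; rewrite mem_index_iota => /andP[kj _].
  rewrite ramp_le0 ?mulr0 //; apply: le_trans tk _.
  by rewrite ler_pM2r // ler_nat.
rewrite (eq_big_nat _ _ (F2 := fun j => al j.+1 - al j)); last first.
  move=> j /andP[_ jk].
  rewrite ramp_ge1 ?mulr1 //; apply: le_trans kt.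
  by rewrite -{2}[h]mul1r -mulrDl natr1 ler_pM2r // ler_nat.
rewrite telescope_sumr // ramp_mid //; last first.
  by rewrite kt -{2}[h]mul1r -mulrDl natr1.
by rewrite addr0; lra.
Qed.

(** Each ramp starts when the previous one ends, so together they follow [t / h], clamped to
    [[0, N]]. *)
Lemma sum_ramp h N t : 0 < h ->
  \sum_(j < N) ramp (j%:R * h) h t = Num.max 0 (Num.min N%:R (t / h)).
Proof.
move=> h0; elim: N => [|N IH].
  by rewrite big_ord0; apply/esym/max_idPl; rewrite ge_min lexx.
rewrite big_ord_recr /= IH /ramp mulrBl mulfK ?gt_eqF // -natr1.
have N0 : 0 <= N%:R :> R by exact: ler0n.
case: (leP N%:R (t / h)) => Nt; case: (leP (N%:R + 1) (t / h)) => tN;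
  case: (leP 1 (t / h - N%:R)) => t1; try by exfalso; lra.
- by rewrite !(max_idPr _) //; lra.
- by rewrite !(max_idPr _) //; lra.
- by rewrite (@max_l _ _ 0 (t / h - N%:R)) ?addr0 //; lra.
Qed.

(** Serves twice: with [n = 1] for the monotonicity of one ramp, with [n = N] for the growth of
    their sum. *)
Lemma clamp_increment (n a b : R) : a <= b ->
  0 <= Num.max 0 (Num.min n b) - Num.max 0 (Num.min n a) <= b - a.
Proof.
move=> ab; have : 0 <= Num.min n b - Num.min n a <= b - a.
  by case: (leP n a) => ?; case: (leP n b) => ?; lra.
move: (Num.min n a) (Num.min n b) => x y.
by case: (leP 0 x) => ?; case: (leP 0 y) => ?; lra.
Qed.

Lemma ramp_nondecreasing a h : 0 < h -> {homo ramp a h : t s / t <= s}.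
Proof.
move=> h0 t s ts; rewrite -subr_ge0.
have ats : (t - a) / h <= (s - a) / h by rewrite ler_pM2r ?invr_gt0 // lerD2r.
by have /andP[] := clamp_increment 1 ats.
Qed.

(* The increments of the ramps between two times are nonnegative and add up to
   at most the elapsed time divided by [h]. *)
Lemma interp_lipschitz al h N : 0 < h ->
  (forall j, `|al j.+1 - al j| <= 1) ->
  forall a b, `|interp al h N b - interp al h N a| <= h^-1 * `|b - a|.
Proof.
move=> h0 al1 a b; wlog ab : a b / a <= b.
  move=> H; case: (leP a b) => [/H//|/ltW /H].
  by rewrite distrC [X in _ <= _ * X]distrC.
rewrite /interp opprD addrACA subrr add0r -sumrB; apply: le_trans (ler_norm_sum _ _ _) _.
apply: (@le_trans _ _
  (\sum_(j < N) (ramp (j%:R * h) h b - ramp (j%:R * h) h a))).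
  apply: ler_sum => j _; rewrite -mulrBr normrM.
  rewrite [X in _ * X]ger0_norm ?subr_ge0 ?ramp_nondecreasing //.
  by rewrite ler_piMl // subr_ge0 ramp_nondecreasing.
rewrite sumrB !sum_ramp // ger0_norm ?subr_ge0 // mulrBr ![h^-1 * _]mulrC.
have ab' : a / h <= b / h by rewrite ler_pM2r ?invr_gt0.
by have /andP[] := clamp_increment N%:R ab'.
Qed.

(** The breakpoints are both ends of all [N] ramps, hence the index [N] is included. *)
Lemma interp_derivable al h N t : 0 < h ->
  t \notin [seq j%:R * h | j <- iota 0 N.+1] -> derivable (interp al h N) t 1.
Proof.
move=> h0 /mapP tN.
have tj j : (j <= N)%N -> t != j%:R * h.
  by move=> jN; apply/eqP => tj; apply: tN; exists j; rewrite // mem_iota ltnS.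
have -> : interp al h N =
    cst (al 0%N) + \sum_(j < N) (cst (al j.+1 - al j) * ramp (j%:R * h) h).
  by apply/funext => s; rewrite /interp /= fctE fct_sumE.
apply: derivableD; first exact: derivable_cst.
apply: derivable_sum => j; apply: derivableM; first exact: derivable_cst.
apply: ramp_derivable => //; first by apply: tj; exact: ltnW.
by rewrite -{2}[h]mul1r -mulrDl natr1 tj.
Qed.

End Interpolation.

(** * Trajectories following a walk, one edge per duration [h] *)

Section Walk.
Variables (R : realType) (G : roadmap R) (w : nat -> G) (h : R) (N : nat).
Hypotheses (h0 : 0 < h) (w_adj : forall j, adj (w j) (w j.+1)).

Definition walk_at (t : R) (u : G) : R :=
  interp (fun j => vertex_pt (w j) u) h N t.

Lemma walk_at_edge k t : (k < N)%N -> k%:R * h <= t <= k.+1%:R * h ->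
  walk_at t = edge_pt (w k) (w k.+1) ((t - k%:R * h) / h).
Proof.
move=> kN kt; apply/funext => u.
by rewrite /walk_at (interp_segment _ h0 kN kt).
Qed.

Lemma walk_at_vertex k : (k < N)%N -> walk_at (k%:R * h) = vertex_pt (w k).
Proof.
move=> kN; rewrite (walk_at_edge kN); last by rewrite lexx ler_pM2r // ler_nat leqnSn.
rewrite subrr mul0r; apply/funext => u.
by rewrite /edge_pt subr0 mul1r mul0r addr0.
Qed.

(** Every coordinate is Lipschitz with constant [h^-1] and no edge is longer than [h], so the speed
    is at most 1. *)
Lemma walk_trajectory (T : R) : T < N%:R * h ->
  (forall u v : G, adj u v -> len u v <= h) -> trajectory T walk_at.
Proof.
move=> TN lenh.
have lip u a b : `|walk_at b u - walk_at a u| <= h^-1 * `|b - a|.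
  apply: interp_lipschitz => // j; rewrite /vertex_pt.
  by do 2!case: eqP => _ /=;
    rewrite ?subrr ?subr0 ?sub0r ?normrN ?normr0 ?normr1.
split.
- move=> t /andP[t0 tT]; right.
  have th : 0 <= t / h by rewrite divr_ge0 // ltW.
  (* [k] is the index of the edge under way at time [t]; [T < N * h] ensures [k < N]. *)
  have /andP[kt tk] := truncn_itv th; set k := Num.truncn _ in kt tk.
  rewrite ler_pdivlMr // in kt; rewrite ltr_pdivrMr // in tk.
  have kN : (k < N)%N.
    rewrite -(ltr_nat R) -(ltr_pM2r h0).
    exact: le_lt_trans kt (le_lt_trans tT TN).
  exists (w k), (w k.+1), ((t - k%:R * h) / h); split => //.
    rewrite divr_ge0 ?subr_ge0 ?(ltW h0) //= ler_pdivrMr // mul1r.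
    by rewrite lerBlDl -{2}[h]mul1r -mulrDl natr1 ltW.
  by apply: walk_at_edge => //; rewrite kt ltW.
- move=> v; apply: continuous_subspaceT.
  exact: (@lipschitz_continuous _ _ h^-1 (lip v)).
- exists [seq j%:R * h | j <- iota 0 N.+1] => t _ tN v.
  exact: interp_derivable.
- move=> t u v _ uv _ _ dt.
  have := lipschitz_derive1_le (lip u) dt.
  rewrite -[h^-1]mulr1 ler_pdivlMl //; apply: le_trans.
  by rewrite ler_wpM2r // lenh.
Qed.

End Walk.

(** * Triangle wave from 0 to [q] and back, of period [2 * q] *)

Definition zigzag (q j : nat) : nat :=
  minn (j %% (2 * q)) (2 * q - j %% (2 * q)).

Lemma zigzag_le q j : (zigzag q j <= q)%N.
Proof. rewrite /zigzag; lia. Qed.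

(** The outward leg of period [p] reaches [o] after [o] steps, so each position recurs every [2 * q]
    steps. *)
Lemma zigzag_offset q p o : (0 < q)%N -> (o <= q)%N ->
  zigzag q (p * (2 * q) + o) = o.
Proof.
by move=> q0 oq; rewrite /zigzag modnMDl modn_small; lia.
Qed.

Lemma zigzag_step q j : (0 < q)%N ->
  ((zigzag q j).+1 == zigzag q j.+1) || ((zigzag q j.+1).+1 == zigzag q j).
Proof.
move=> q0; rewrite /zigzag.
have -> : (j.+1 %% (2 * q) = (j %% (2 * q)).+1 %% (2 * q))%N.
  by rewrite -addn1 -modnDml addn1.
have : (j %% (2 * q) < 2 * q)%N by rewrite ltn_mod; lia.
move: (j %% (2 * q))%N => r; rewrite leq_eqVlt => /predU1P[rq|rq].
  (* Last step of a period: the residue wraps from [2 * q - 1] to 0. *)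
  by rewrite rq modnn; lia.
by rewrite (modn_small rq); lia.
Qed.

(** * Upper bound on the refresh time of the chain *)

Section UpperBound.
Variables (R : realType) (G : roadmap R) (tau : open_tour G).
Let L := tour_edges tau.

Lemma chain_len_le (i j : chain_roadmap tau) : adj i j ->
  len i j <= longest_edge G.
Proof.
have step (k l : chain_roadmap tau) :
    k.+1 = l :> nat -> len k l <= longest_edge G.
  move=> kl; rewrite /= /chain_len; apply: len_le_longest.
  rewrite /tour_vertex -kl /=.
  have := tour_path tau => /(pathP (tour_start tau)); apply.
  by rewrite -ltnS kl.
by case/orP=> /eqP /step //; rewrite len_sym.
Qed.

Lemma min_refresh_time_chain_le (m : nat) (Tf : R) :
  (1 < #|G|)%N -> 0 <= Tf -> (0 < m <= L)%N ->
  min_refresh_time (chain_roadmap tau) m Tf <=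
    2 * (L %/ m)%:R * longest_edge G.
Proof.
move=> n1 Tf0 /andP[m0 mL]; have h0 := longest_gt0 n1.
set h := longest_edge G in h0 *; set q := (L %/ m)%N.
have q0 : (0 < q)%N by rewrite divn_gt0.
have qL : (q <= L)%N by exact: leq_div.
have Lq : (L < m * q.+1)%N by rewrite mulnC ltn_ceil.
(* Enough steps to outlast the horizon. *)
pose N := (Num.truncn (Tf / h)).+1.
have TN : Tf < N%:R * h by rewrite -ltr_pdivrMr // truncnS_gt.
(* Robot [i] sweeps the [q + 1] vertices from [a i] on. The cap [L - q] keeps the block inside the
   chain, and [L < m * q.+1] makes the blocks cover it. *)
pose a i := minn (i * q.+1) (L - q).
have wL i j : (a i + zigzag q j < L.+1)%N.
  by have := zigzag_le q j; rewrite /a; lia.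
pose w i j : chain_roadmap tau := Ordinal (wL i j).
have w_adj i j : adj (w i j) (w i j.+1).
  by have := zigzag_step j q0; rewrite /= /chain_adj /= -!addnS !eqn_add2l.
pose X : team (chain_roadmap tau) m := fun i => walk_at (w i) h N.
have XT : team_trajectory Tf X.
  by move=> i; apply: walk_trajectory => // u v; exact: chain_len_le.
apply: (@le_trans _ _ (refresh_time Tf X)).
  apply: ge_inf; last by exists X.
  by exists 0 => _ [Y _ <-]; exact: bigmax_ge_id.
apply: bigmax_le => [|v _].
  by rewrite !mulr_ge0 // ltW.
have [[t1 t2] Ot ->] := refresh_gap_max v X Tf0.
case: Ot => /= /andP[t10 _] /andP[_ t2T] _ nv.
rewrite leNgt; apply/negP => gap.
have vL : (v <= L)%N by rewrite -ltnS; exact: (ltn_ord v).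
have im : (v %/ q.+1 < m)%N by rewrite ltn_divLR //; exact: leq_ltn_trans Lq.
(* Robot [i] has [v] in its block, at offset [o]. *)
pose i := (v %/ q.+1)%N; pose o := (v - a i)%N.
have iv : (i * q.+1 <= v)%N by exact: leq_trunc_div.
have vi : (v < i * q.+1 + q.+1)%N by rewrite -mulSnr ltn_ceil.
have av : (a i <= v)%N by rewrite /a; lia.
have oq : (o <= q)%N by rewrite /o /a; lia.
have q0' : 0 < 2 * q%:R :> R by rewrite mulr_gt0 // ltr0n.
(* The floor [P] of [y] makes [k = P * (2 * q) + o] the first outward passage at [v] strictly after
   [t1]. It comes within [2 * q] steps, hence before [t2]. Adding [2 * q] keeps [y] nonnegative, as
   [o <= q]. *)
pose y := (t1 / h - o%:R + 2 * q%:R) / (2 * q%:R).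
have th0 : 0 <= t1 / h by rewrite divr_ge0 // ltW.
have oq' : o%:R <= q%:R :> R by rewrite ler_nat.
have y0 : 0 <= y by rewrite divr_ge0 //; lra.
have /andP[] := truncn_itv y0; set P := Num.truncn y.
rewrite ler_pdivlMr // ltr_pdivrMr // -[P.+1%:R]natr1 => Py yP.
pose k := (P * (2 * q) + o)%N.
have kE : k%:R = P%:R * (2 * q%:R) + o%:R :> R by rewrite natrD !natrM.
have t1k : t1 < k%:R * h by rewrite -ltr_pdivrMr // kE; lra.
have kt2 : k%:R * h < t2.
  apply: (@le_lt_trans _ _ (t1 + 2 * q%:R * h)); last by lra.
  rewrite -[t1](@divfK _ h) ?gt_eqF // -mulrDl ler_pM2r // kE; lra.
have kN : (k < N)%N.
  rewrite -(ltr_nat R) -(ltr_pM2r h0).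
  exact: lt_trans kt2 (le_lt_trans t2T TN).
apply: (nv (Ordinal im) (k%:R * h)); first by rewrite t1k.
rewrite /X walk_at_vertex //; suff -> : w (Ordinal im) k = v by [].
apply: val_inj => /=.
by rewrite zigzag_offset // subnKC.
Qed.

End UpperBound.

(** * Combination of the two bounds *)

Theorem mainTheorem11 (R : realType) (G : roadmap R) (m : nat)
    (T1 Tf : R) (tau : open_tour G)
    (m_gt0 : (0 < m)%N) (m_lt_n : (m < #|G|)%N)
    (T1_visits : single_robot_visits_all G T1) (T1_lt_Tf : T1 < Tf)
    (tau_edges : tour_edges tau = (2 * #|G| - 4)%N) :
  min_refresh_time (chain_roadmap tau) m Tf
    <= ((#|G|%:R - 2) / #|G|%:R) * (8 * edge_ratio G)
       * min_refresh_time G m Tf.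
Proof.
have n1 : (1 < #|G|)%N by exact: leq_trans m_lt_n.
(* For [n = 2] the tour would have no edge, hence only one vertex. From [n >= 3] follows
   [m <= n - 1 <= 2 * n - 4], so that [q] is positive. *)
have n3 : (2 < #|G|)%N.
  have : (#|G| <= (tour_edges tau).+1)%N.
    rewrite -[(_).+1]/(size (tour_start tau :: tour_tail tau)) cardE.
    by apply: uniq_leq_size => [|v _]; [exact: enum_uniq | exact: tour_covers].
  by rewrite tau_edges; lia.
have Tf0 : 0 <= Tf.
  have [x _ xv] := T1_visits; have [t /andP[t0 tT] _] := xv (tour_start tau).
  exact: le_trans t0 (le_trans tT (ltW T1_lt_Tf)).
have l0 := shortest_gt0 n1; have h0 := longest_gt0 n1.
have mr0 : 0 < m%:R :> R by rewrite ltr0n.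
have nr0 : 0 < #|G|%:R :> R by rewrite ltr0n ltnW.
have := @min_refresh_time_ge _ G m T1 Tf n1; rewrite m_gt0 m_lt_n.
move=> /(_ isT T1_visits T1_lt_Tf) low.
have L_ge : (0 < m <= tour_edges tau)%N by rewrite tau_edges; lia.
apply: le_trans (min_refresh_time_chain_le n1 Tf0 L_ge) _.
set q := (_ %/ m)%N; set r := min_refresh_time G m Tf in low *.
set l := shortest_edge G in l0 low; set h := longest_edge G in h0 *.
have qm : q%:R * m%:R <= 2 * (#|G|%:R - 2) :> R.
  have -> : 2 * (#|G|%:R - 2) = (tour_edges tau)%:R :> R.
    by rewrite tau_edges natrB; [rewrite natrM; lra | lia].
  by rewrite -natrM ler_nat leq_trunc_div.
have -> : (#|G|%:R - 2) / #|G|%:R * (8 * edge_ratio G) * r =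
    8 * (#|G|%:R - 2) * h * (r / (#|G|%:R * l)).
  by rewrite /edge_ratio -/h -/l; field; rewrite !gt_eqF.
have rl : (2 * m%:R)^-1 <= r / (#|G|%:R * l).
  by rewrite ler_pdivlMr ?mulr_gt0 // ler_pdivrMl ?mulr_gt0.
have n2 : 0 <= #|G|%:R - 2 :> R by rewrite subr_ge0 ler_nat ltnW.
(* With the lower bound in the form [rl], what remains is [2 * q * h <= 8 * (n - 2) * h / (2 * m)],
   which is [qm] times [4 * h]. *)
apply: le_trans (ler_wpM2l _ rl); last by rewrite !mulr_ge0 // ltW.
rewrite ler_pdivlMr ?mulr_gt0 //.
have := ler_wpM2r (ltW h0) qm; lra.
Qed.
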